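(* For any integer $n \geq 2$, the $3$-Stirling colour graph $\mathcal{S}_3(K_{1,n})$ of the star $K_{1,n}$ is Hamiltonian if and only if $n$ is odd.
   Context: Graphs are finite and simple. $K_{1,n}$ is the star with $n$ leaves (and $n+1$ vertices). For a graph $G$ and a positive integer $k$, the $k$-Stirling colour graph of $G$, denoted $\mathcal{S}_k(G)$, is the graph whose vertices are the partitions of $V(G)$ into exactly $k$ non-empty independent sets, with different partitions $p_1$ and $p_2$ being adjacent if there is a vertex $x \in V(G)$ such that the restrictions of $p_1$ and $p_2$ to $V(G)-\{x\}$ are equal (after restriction, empty cells are discarded). A graph is Hamiltonian if it has a cycle containing all of its vertices; in particular a Hamiltonian graph has at least three vertices, so $K_1$ and $K_2$ are not Hamiltonian. *)

(* Defs.v *)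
From HB Require Import structures.
From mathcomp Require Import all_boot.

Set Implicit Arguments.
Unset Strict Implicit.
Unset Printing Implicit Defensive.

Record sgraph := SGraph {
  svertex :> finType;
  sedge : rel svertex;
  sedge_sym : symmetric sedge;
  sedge_irrefl : irreflexive sedge
}.

Definition independent (G : sgraph) (A : {set G}) : bool :=
  [forall x in A, forall y in A, ~~ sedge x y].

(* The bound on the size excludes the degenerate closed walks of length at
   most 2 that [ucycle] accepts, so K_1 and K_2 are not Hamiltonian. *)
Definition hamiltonian (G : sgraph) : Prop :=
  exists c : seq G, [/\ 2 < size c, ucycle (@sedge G) c & forall x : G, x \in c].

(* The centre is [None], the leaves are [Some i]. *)
Definition star_edge (n : nat) : rel (option 'I_n) :=
  fun u v => (u == None) != (v == None).

Lemma star_edge_sym n : symmetric (@star_edge n).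
Proof. by move=> u v; rewrite /star_edge eq_sym. Qed.

Lemma star_edge_irrefl n : irreflexive (@star_edge n).
Proof. by move=> u; rewrite /star_edge eqxx. Qed.

Definition star (n : nat) : sgraph :=
  SGraph (@star_edge_sym n) (@star_edge_irrefl n).

Section StirlingGraph.

Variables (G : sgraph) (k : nat).

(* MathComp's [partition] already requires the cells to be non-empty. *)
Definition independent_partition (P : {set {set G}}) : bool :=
  [&& partition P [set: G], #|P| == k & [forall A in P, independent A]].

Definition stirling_vertex := {P : {set {set G}} | independent_partition P}.

Definition restrict_partition (P : {set {set G}}) (x : G) : {set {set G}} :=
  [set A :\ x | A in P] :\ set0.

Definition stirling_edge : rel stirling_vertex :=
  fun p1 p2 => (p1 != p2) &&
    [exists x : G, restrict_partition (val p1) x == restrict_partition (val p2) x].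

Lemma stirling_edge_sym : symmetric stirling_edge.
Proof.
move=> p1 p2; rewrite /stirling_edge eq_sym; congr (_ && _).
by apply: eq_existsb => x; rewrite eq_sym.
Qed.

Lemma stirling_edge_irrefl : irreflexive stirling_edge.
Proof. by move=> p; rewrite /stirling_edge eqxx. Qed.

Definition stirling_graph : sgraph :=
  SGraph stirling_edge_sym stirling_edge_irrefl.

End StirlingGraph.

(* Main.v *)
Require Import Defs.
From HB Require Import structures.
From mathcomp Require Import all_boot.
From mathcomp Require Import zify.

Set Implicit Arguments.
Unset Strict Implicit.
Unset Printing Implicit Defensive.

(** In a partition of the star into three independent cells the centre is alone,
    so the other two cells split the leaves into X and its complement.  There
    are [(2 ^ n.-1).-1] such partitions, and two of them are adjacent when they
    differ by moving one leaf: the graph is the folded cube of dimension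
    [n.-1] without its origin.

    Suppose [n] is even.  Then X and its complement have sizes of the same
    parity, so that parity depends on the partition alone, and moving a leaf
    changes it ([edge_flips_parity]).  The graph is bipartite with an odd number
    of vertices ([card_vertices]), so it has no Hamiltonian cycle
    ([two_coloured_cycle_even]).

    Suppose [n] is odd.  Choosing the cell that avoids the last leaf identifies
    the vertices with the nonzero bit vectors of even length [n.-1], and every
    edge of the cube with an edge of the graph; moving the last leaf joins each
    vector to its bitwise complement.  A path through all nonzero vectors of
    the cube from 10..0 to its complement 01..1 therefore closes up into a
    Hamiltonian cycle ([hamiltonian_odd_star]).  Such a path is built by
    recursion, two dimensions at a time, out of Gray codes ([punctured]). *)

(** * Cycles in two-coloured graphs *)

Lemma two_coloured_cycle_even (T : eqType) (e : rel T) (f : T -> bool) (c : seq T) :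
  (forall x y, e x y -> f y = ~~ f x) -> cycle e c -> ~~ odd (size c).
Proof.
move=> ef; have pathP x p : path e x p -> f (last x p) = f x (+) odd (size p).
  elim: p x => [|y p IHp] x /=; first by rewrite addbF.
  by case/andP=> /ef fy /IHp ->; rewrite fy addNb addbN.
case: c => [|x p] //= /pathP; rewrite last_rcons size_rcons /=.
by case: (f x); case: (odd _).
Qed.

(** * Gray codes and paths in the cube *)

Lemma sorted_cat_join (T : Type) (e : rel T) (x0 : T) (s t : seq T) :
    0 < size s -> 0 < size t ->
  sorted e (s ++ t) =
    [&& sorted e s, e (last x0 s) (head x0 t) & sorted e t].
Proof. by case: s t => [|x s] [|y t] //= _ _; rewrite cat_path. Qed.

Fixpoint cube_adj (x y : seq bool) : bool :=
  match x, y with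
  | a :: x', b :: y' => if a == b then cube_adj x' y' else x' == y'
  | _, _ => false
  end.

Lemma cube_adjC : symmetric cube_adj.
Proof.
elim=> [|a x IHx] [|b y] //=.
by rewrite IHx (eq_sym a) (eq_sym x).
Qed.

Lemma cube_adjxx x : cube_adj x x = false.
Proof. by elim: x => //= a x; rewrite eqxx. Qed.

Lemma cube_adj_cat z x y : cube_adj x y -> cube_adj (x ++ z) (y ++ z).
Proof.
elim: x y => [|a x IHx] [|b y] //=; case: ifP => _; first exact: IHx.
by move/eqP->.
Qed.

Lemma cube_adj_flip x z b : cube_adj (x ++ b :: z) (x ++ ~~ b :: z).
Proof. by elim: x => [|a x IHx] /=; [case: b; rewrite /= eqxx | rewrite eqxx]. Qed.

Lemma cube_adj_nth x y : cube_adj x y ->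
  exists2 i, i < size x & forall j, j != i -> nth false x j = nth false y j.
Proof.
elim: x y => [|a x IHx] [|b y] //=; case: eqP => [-> /IHx|_ /eqP->].
  by case=> i lt_i agree; exists i.+1 => // -[|j] //=; rewrite eqSS; apply: agree.
by exists 0 => // -[].
Qed.

(** The reflected Gray code started at an arbitrary vertex [u]: a path through
    all vectors of length [size u], from [u] to [u] with its first bit
    flipped ([head_gray], [last_gray]). *)
Fixpoint gray (u : seq bool) : seq (seq bool) :=
  if u is b :: u' then map (cons b) (gray u') ++ map (cons (~~ b)) (rev (gray u'))
  else [:: [::]].

Lemma size_gray u : size (gray u) = 2 ^ size u.
Proof.
elim: u => //= b u IHu.
by rewrite size_cat !size_map size_rev IHu addnn -mul2n expnS.
Qed.

Lemma gray_gt0 u : 0 < size (gray u).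
Proof. by rewrite size_gray expn_gt0. Qed.

Lemma head_gray u : head [::] (gray u) = u.
Proof.
by elim: u => //= b u; case: (gray u) (gray_gt0 u) => //= x s _ ->.
Qed.

Lemma last_gray b u : last [::] (gray (b :: u)) = ~~ b :: u.
Proof.
rewrite /= last_cat -[in RHS](head_gray u).
case: (gray u) (gray_gt0 u) => //= x s _.
by rewrite rev_cons map_rcons last_rcons.
Qed.

Lemma sorted_gray u : sorted cube_adj (gray u).
Proof.
elim: u => //= b u IHu.
have g0 := gray_gt0 u.
rewrite (sorted_cat_join _ [::]) ?size_map ?size_rev //.
rewrite !sorted_map rev_sorted /=.
have cons_adj a : relpre (cons a) cube_adj =2 cube_adj by move=> x y /=; rewrite eqxx.
rewrite (eq_sorted (cons_adj b)) IHu /=; apply/andP; split; last first.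
  by rewrite (@eq_sorted _ _ cube_adj) // => x y; rewrite /= eqxx cube_adjC.
case/lastP: (gray u) g0 => // s x _.
by rewrite rev_rcons map_rcons last_rcons; exact: (cube_adj_flip [::]).
Qed.

Lemma uniq_gray u : uniq (gray u).
Proof.
elim: u => //= b u IHu; have cons_inj (a : bool) : injective (cons a) by move=> x y [].
rewrite cat_uniq !(map_inj_uniq (cons_inj _)) rev_uniq IHu andbT /=.
by apply/hasPn=> _ /mapP[x _ ->]; apply/mapP=> -[y _ [/esym]]; case: b.
Qed.

Lemma gray_size u x : x \in gray u -> size x = size u.
Proof.
elim: u x => [|b u IHu] x /=; first by rewrite inE => /eqP->.
by rewrite mem_cat => /orP[] /mapP[y]; rewrite ?mem_rev => /IHu <- ->.
Qed.

(** A path through the nonzero vectors of length [2k+2], from 10..0 to its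
    complement 01..1.  For the step write s for 01..1 and s' for 11..1, and
    append two bits, so that the larger cube splits into four layers.  In layer
    00 follow the previous path up to s.  Step to s in layer 10 and follow a
    Gray code there from s to s'.  Step to s' in layer 11; the layers 01 and
    11 form together a cube of dimension [2k+3], and a Gray code of this cube
    leads back to the neighbour s of s' in layer 11, that is, to the vector
    01..1 of the larger cube. *)
Fixpoint punctured (k : nat) : seq (seq bool) :=
  if k is k'.+1 then
    map (cat^~ [:: false; false]) (punctured k') ++
    (map (cat^~ [:: true; false]) (gray (false :: nseq k'.*2.+1 true)) ++
     map (cat^~ [:: true]) (gray (nseq k'.*2.+3 true)))
  else [:: [:: true; false]; [:: true; true]; [:: false; true]].

Lemma size_punctured k : (size (punctured k)).+1 = 2 ^ k.*2.+2.
Proof.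
elim: k => // k IHk; rewrite [punctured _]/punctured -/punctured.
rewrite !size_cat !size_map -addSn IHk !size_gray /= !size_nseq.
rewrite doubleS !expnS; lia.
Qed.

Lemma punctured_gt0 k : 0 < size (punctured k).
Proof. by rewrite -ltnS size_punctured !expnS; have := expn_gt0 2 k.*2; lia. Qed.

Lemma nseq_catr (T : Type) (a : T) k : nseq k a ++ [:: a] = nseq k.+1 a.
Proof. by elim: k => //= k ->. Qed.

Lemma head_cat_gt0 (T : Type) (x0 : T) (s t : seq T) :
  0 < size s -> head x0 (s ++ t) = head x0 s.
Proof. by case: s. Qed.

Lemma last_cat_gt0 (T : Type) (x0 : T) (s t : seq T) :
  0 < size t -> last x0 (s ++ t) = last x0 t.
Proof. by rewrite last_cat; case: t. Qed.

Lemma last_map_cat (z : seq bool) (s : seq (seq bool)) :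
  0 < size s -> last [::] (map (cat^~ z) s) = last [::] s ++ z.
Proof. by case: s => //= x s _; rewrite -[LHS]/(last (cat^~ z x) _) last_map. Qed.

Lemma head_map_cat (z : seq bool) (s : seq (seq bool)) :
  0 < size s -> head [::] (map (cat^~ z) s) = head [::] s ++ z.
Proof. by case: s. Qed.

Lemma head_punctured k : head [::] (punctured k) = true :: nseq k.*2.+1 false.
Proof.
elim: k => // k IHk; rewrite [punctured _]/punctured -/punctured.
rewrite head_cat_gt0 ?size_map ?punctured_gt0 //.
rewrite head_map_cat ?punctured_gt0 // IHk doubleS cat_cons.
by rewrite -(cat1s false [:: false]) catA !nseq_catr.
Qed.

Lemma last_punctured k : last [::] (punctured k) = false :: nseq k.*2.+1 true.
Proof.
case: k => // k; rewrite [punctured _]/punctured -/punctured.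
rewrite !last_cat_gt0 ?size_cat ?size_map ?addn_gt0 ?gray_gt0 ?orbT //.
by rewrite last_map_cat ?gray_gt0 // last_gray doubleS -(nseq_catr true k.*2.+2).
Qed.

Lemma sorted_map_cat z s :
  sorted cube_adj s -> sorted cube_adj (map (cat^~ z) s).
Proof.
rewrite sorted_map; apply: sub_sorted => x y /=; exact: cube_adj_cat.
Qed.

Lemma sorted_punctured k : sorted cube_adj (punctured k).
Proof.
elim: k => // k IHk; rewrite [punctured _]/punctured -/punctured.
have [g1 g2] := (gray_gt0 (false :: nseq k.*2.+1 true), gray_gt0 (nseq k.*2.+3 true)).
have p0 := punctured_gt0 k.
rewrite !(sorted_cat_join _ [::]) ?size_cat ?addn_gt0 ?size_map ?p0 ?g1 ?g2 //.
rewrite !sorted_map_cat ?sorted_gray // andbT.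
rewrite head_cat_gt0 ?size_map // !last_map_cat // !head_map_cat //.
rewrite last_gray !head_gray last_punctured; apply/and4P; split=> //.
  exact: cube_adj_flip.
have -> : nseq k.*2.+3 true = (~~ false :: nseq k.*2.+1 true) ++ [:: true].
  exact: (esym (nseq_catr true k.*2.+2)).
by rewrite -(cat1s true [:: false]) catA; apply: cube_adj_flip.
Qed.

Lemma punctured_size k x : x \in punctured k -> size x = k.*2.+2.
Proof.
elim: k x => [|k IHk] x; first by rewrite !inE => /or3P[] /eqP->.
rewrite [punctured _]/punctured -/punctured !mem_cat doubleS.
case/or3P=> /mapP[y yP ->]; rewrite size_cat /= addnC.
- by rewrite IHk.
- by rewrite (gray_size yP) /= size_nseq.
- by rewrite (gray_size yP) size_nseq.
Qed.

Lemma punctured_neq0 k x : x \in punctured k -> true \in x.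
Proof.
elim: k x => [|k IHk] x; first by rewrite !inE => /or3P[] /eqP->.
rewrite [punctured _]/punctured -/punctured !mem_cat.
by case/or3P=> /mapP[y yP ->]; rewrite mem_cat ?inE ?eqxx ?orbT // IHk.
Qed.

Lemma uniq_punctured k : uniq (punctured k).
Proof.
elim: k => // k IHk; rewrite [punctured _]/punctured -/punctured.
have cat_inj (z : seq bool) : injective (cat^~ z).
  by apply: (can_inj (g := fun s => take (size s - size z) s)) => x;
     rewrite size_cat addnK take_size_cat.
rewrite !cat_uniq !map_inj_uniq ?IHk ?uniq_gray //= andbT.
(* The three pieces have different last bits, which [rev] brings to the front. *)
apply/andP; split; apply/hasPn=> w.
  rewrite mem_cat => wP; apply/mapP=> -[x _ defw].
  case/orP: wP => /mapP[y _]; rewrite defw => /(congr1 rev);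
    by rewrite !rev_cat.
by case/mapP=> x _ ->; apply/mapP=> -[y _] /(congr1 rev); rewrite !rev_cat.
Qed.

(** * Vertices of the colour graph *)

Definition leaf_cells n (X : {set 'I_n}) : {set {set star n}} :=
  [set [set None]; [set Some i | i in X]; [set Some i | i in ~: X]].

Lemma mem_leaf n (X : {set 'I_n}) i : (Some i \in [set Some j | j in X]) = (i \in X).
Proof. by rewrite mem_imset //; apply: Some_inj. Qed.

Lemma centre_notin_leaf n (X : {set 'I_n}) : (None \in [set Some j | j in X]) = false.
Proof. by apply/imsetP=> -[]. Qed.

Definition leafE := (mem_leaf, centre_notin_leaf).

Lemma leaf_cellsC n (X : {set 'I_n}) : leaf_cells (~: X) = leaf_cells X.
Proof. by rewrite /leaf_cells setCK -!setUA (setUC [set [set _ | _ in ~: X]]). Qed.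

Lemma mem_leaf_cells n (X : {set 'I_n}) :
  [set Some i | i in X] \in leaf_cells X.
Proof. by rewrite !inE eqxx orbT. Qed.

Lemma leaf_cells_cell n (X : {set 'I_n}) B :
  B \in leaf_cells X ->
  B = [set None] \/ exists2 Y, leaf_cells Y = leaf_cells X & B = [set Some i | i in Y].
Proof.
rewrite !inE -orbA => /or3P[] /eqP->; [by left|right; by exists X|right].
by exists (~: X); rewrite ?leaf_cellsC.
Qed.

(** A leaf [i] outside both sets excludes the only other possibility, that [X]
    and [Y] are complementary. *)
Lemma leaf_cells_inj n (X Y : {set 'I_n}) i :
  i \notin X -> i \notin Y -> leaf_cells X = leaf_cells Y -> X = Y.
Proof.
move=> iX iY eqXY; have := mem_leaf_cells X; rewrite eqXY !inE -orbA.
case/or3P=> /eqP/setP eqB.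
- by have := eqB None; rewrite centre_notin_leaf inE.
- by apply/setP=> j; have := eqB (Some j); rewrite !leafE.
- by have := eqB (Some i); rewrite !leafE inE (negbTE iX) iY.
Qed.

Lemma leaf_cells_vertex n (X : {set 'I_n}) :
  X != set0 -> X != setT -> @independent_partition (star n) 3 (leaf_cells X).
Proof.
move=> /set0Pn[a aX]; rewrite -subTset => /subsetPn[b _ bX].
have neq (S S' : {set star n}) u : u \in S -> u \notin S' -> S != S'.
  by move=> uS; apply: contraNneq => <-.
have neq1 : [set Some i | i in ~: X] != [set Some i | i in X].
  by apply: (neq _ _ (Some b)); rewrite leafE // inE.
have neq2 (Y : {set 'I_n}) : [set None] != [set Some i | i in Y].
  by apply: (neq _ _ None); rewrite ?leafE ?inE.
apply/and3P; split.
- apply/and3P; split.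
  + rewrite eqEsubset subsetT; apply/subsetP=> -[i|] _; apply/bigcupP.
      case iX: (i \in X).
        by exists [set Some i | i in X]; rewrite ?leafE // mem_leaf_cells.
      by exists [set Some i | i in ~: X]; rewrite ?leafE ?inE ?iX // eqxx !orbT.
    by exists [set None]; rewrite !inE ?eqxx.
  + apply/trivIsetP=> A B; rewrite !inE -!orbA.
    by case/or3P=> /eqP-> /or3P[] /eqP->; rewrite ?eqxx // => _;
      rewrite -setI_eq0; apply/eqP/setP=> -[i|]; rewrite !inE ?leafE ?inE //;
      case: (i \in X).
  + by rewrite !inE -!orbA; apply/or3P=> -[] /eqP/setP E;
      [have := E None | have := E (Some a) | have := E (Some b)];
      rewrite ?leafE !inE ?aX ?bX.
- have neq3 : [set Some i | i in ~: X] != [set None] by rewrite eq_sym neq2.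
  by rewrite /leaf_cells setUC cardsU1 cards2 !inE negb_or neq1 neq2 neq3.
- apply/forall_inP=> A; rewrite !inE -orbA.
  by case/or3P=> /eqP->; apply/forall_inP=> u uA; apply/forall_inP=> v;
    move: uA; case: u v => [i|] [j|]; rewrite ?inE ?leafE.
Qed.

(** Every leaf is adjacent to the centre, so the cell of the centre is a
    singleton; of the two remaining cells, [X] is the one that avoids [i]. *)
Lemma vertex_leaf_cells n (P : {set {set star n}}) (i : 'I_n) :
  @independent_partition (star n) 3 P ->
  exists X : {set 'I_n}, [/\ i \notin X, X != set0 & P = leaf_cells X].
Proof.
case/and3P=> /and3P[/eqP covP tiP P0] /eqP cardP /forall_inP indP.
have /bigcupP[C CP NC] : None \in cover P by rewrite covP inE.
have defC : C = [set None].
  apply/setP=> -[j|]; rewrite inE //=; apply/negP=> jC.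
  by have /forall_inP/(_ _ jC)/forall_inP/(_ _ NC) := indP _ CP.
have card2 : #|P :\ [set None]| = 2.
  by apply/eqP; rewrite -eqSS -cardP (cardsD1 [set None] P) -defC CP.
have [A [B [AB defP]]] := cards2P _ (introT eqP card2).
have uniq_cell D E u : D \in P -> E \in P -> u \in D -> u \in E -> D = E.
  by move=> DP EP uD uE; rewrite -(def_pblock tiP DP uD) (def_pblock tiP EP uE).
have wlog_i (A' B' : {set star n}) : P :\ [set None] = [set A'; B'] ->
    A' != B' -> Some i \in B' ->
  exists X : {set 'I_n}, [/\ i \notin X, X != set0 & P = leaf_cells X].
  move=> {A B AB}defP neqAB iB.
  have /setD1P[A1 AP] : A' \in P :\ [set None] by rewrite defP !inE eqxx.
  have /setD1P[B1 BP] : B' \in P :\ [set None] by rewrite defP !inE eqxx orbT.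
  have NA : None \notin A'.
    by apply: contraNN A1 => NA; rewrite -defC (uniq_cell _ _ _ AP CP NA NC).
  have NB : None \notin B'.
    by apply: contraNN B1 => NB; rewrite -defC (uniq_cell _ _ _ BP CP NB NC).
  have notAB j : Some j \in A' -> Some j \in B' -> False.
    by move=> jA jB; case/eqP: neqAB; apply: uniq_cell jA jB.
  pose X := [set j | Some j \in A'].
  have defA : A' = [set Some j | j in X].
    by apply/setP=> -[j|]; rewrite leafE ?inE //; apply: negbTE.
  have defB : B' = [set Some j | j in ~: X].
    apply/setP=> -[j|]; rewrite leafE ?inE; last exact: negbTE.
    apply/idP/idP => [jB|jA]; first by apply/negP=> /notAB; apply.
    have /bigcupP[D DP jD] : Some j \in cover P by rewrite covP inE.
    have : D \in P :\ [set None].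
      by rewrite !inE DP andbT; apply: contraTneq jD => ->; rewrite inE.
    rewrite defP !inE => /orP[] /eqP defD; last by rewrite -defD.
    by rewrite -defD jD in jA.
  exists X; split.
  - by rewrite inE; apply/negP=> /notAB; apply.
  - by apply: contraNneq P0 => X0; rewrite -(imset0 (Some : 'I_n -> star n)) -X0 -defA.
  - by rewrite -(setD1K CP) defC defP /leaf_cells -setUA -defA -defB.
have : Some i \in cover P by rewrite covP inE.
case/bigcupP=> D DP iD; have : D \in P :\ [set None].
  by rewrite !inE DP andbT; apply: contraTneq iD => ->; rewrite inE.
rewrite defP !inE => /orP[] /eqP defD; rewrite defD in iD.
  by apply: (wlog_i B A) => //; rewrite 1?setUC 1?eq_sym.
exact: (wlog_i A B).
Qed.

(** Choosing the leaf cell that avoids the last leaf counts each partition once. *)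
Lemma card_vertices n : #|{: stirling_vertex (star n.+1) 3}| = (2 ^ n).-1.
Proof.
have inD (X : {set 'I_n.+1}) :
    (X \in powerset [set~ ord_max] :\ set0) = (X != set0) && (ord_max \notin X).
  by rewrite !inE subsetC sub1set inE.
rewrite card_sig.
have -> : #|[pred P | @independent_partition (star n.+1) 3 P]| =
   #|[set leaf_cells X | X : {set 'I_n.+1} in powerset [set~ ord_max] :\ set0]|.
  apply: eq_card => P; rewrite inE; apply/idP/imsetP => [|[X]].
    case/(vertex_leaf_cells ord_max) => X [iX X0 ->]; exists X => //.
    by rewrite inD X0.
  rewrite inD => /andP[X0 iX] ->; apply: leaf_cells_vertex => //.
  by apply: contraNneq iX => ->; rewrite inE.
rewrite card_in_imset => [|X Y].
  have := cardsD1 set0 (powerset [set~ (@ord_max n)]).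
  by rewrite card_powerset cardsC1 card_ord !inE sub0set => ->.
rewrite !inD => /andP[_ iX] /andP[_ iY].
exact: leaf_cells_inj iX iY.
Qed.

(** * Edges of the colour graph *)

(** Deleting a vertex may empty one leaf cell, and cells are unordered.  With
    two leaves there is a leaf [j] other than [x]; the cell of [j] survives the
    deletion of [x], so it agrees off [x] with a leaf cell of the other
    partition.  [X'] and [Y'] are these two cells; a leaf cell determines its
    whole partition. *)
Lemma cells_agree n (X Y : {set 'I_n}) (x : star n) : 2 <= n ->
    restrict_partition (leaf_cells X) x = restrict_partition (leaf_cells Y) x ->
  exists X' Y' : {set 'I_n}, [/\ leaf_cells X' = leaf_cells X,
    leaf_cells Y' = leaf_cells Y &
    forall j, Some j != x -> (j \in X') = (j \in Y')].
Proof.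
move=> n2 eqXY.
have [j jx] : exists j : 'I_n, Some j != x.
  case: n n2 X Y x eqXY => [|[|n]] // _ _ _ [i|] _; last by exists ord0.
  by exists (lift i ord0); apply/eqP=> -[/esym]; apply/eqP; exact: neq_lift.
have [X' eqX jX] : exists2 X', leaf_cells X' = leaf_cells X & j \in X'.
  by case jX: (j \in X); [exists X | exists (~: X); rewrite ?leaf_cellsC // inE jX].
have : [set Some i | i in X'] :\ x \in restrict_partition (leaf_cells Y) x.
  rewrite -eqXY -eqX in_setD1 (imset_f (fun A => A :\ x)) ?mem_leaf_cells // andbT.
  by apply/set0Pn; exists (Some j); rewrite !inE jx leafE.
rewrite !inE => /andP[_ /imsetP[B /leaf_cells_cell[->|[Y' eqY ->]] /setP eqB]].
  by have := eqB (Some j); rewrite !inE jx leafE jX.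
by exists X', Y'; split=> // i ix; have := eqB (Some i); rewrite !inE ix !leafE.
Qed.

Lemma restrict_leaf_cells n (X Y : {set 'I_n}) i :
    (forall j, j != i -> (j \in X) = (j \in Y)) ->
  restrict_partition (leaf_cells X) (Some i : star n) =
  restrict_partition (leaf_cells Y) (Some i : star n).
Proof.
move=> agree; rewrite /restrict_partition /leaf_cells !imsetU !imset_set1.
have eqD (Z W : {set 'I_n}) : (forall j, j != i -> (j \in Z) = (j \in W)) ->
    [set Some j | j in Z] :\ Some i = [set Some j | j in W] :\ Some i.
  move=> eqZW; apply/setP=> -[j|]; rewrite !inE ?leafE //.
  by case: eqVneq => //= neq; apply: eqZW; apply: contraNneq neq => ->.
rewrite (eqD X Y) // (eqD (~: X) (~: Y)) // => j neq_j.
by rewrite !inE agree.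
Qed.

Lemma leaf_edge n (p q : stirling_vertex (star n) 3) (X Y : {set 'I_n}) i :
    val p = leaf_cells X -> val q = leaf_cells Y -> p != q ->
    (forall j, j != i -> (j \in X) = (j \in Y)) ->
  stirling_edge p q.
Proof.
move=> defp defq neq_pq agree; rewrite /stirling_edge neq_pq; apply/existsP.
by exists (Some i); rewrite defp defq (restrict_leaf_cells agree).
Qed.

(** * Even number of leaves *)

(** The cell of the centre has size 1, so for an even number of leaves this
    tells the common parity of the two leaf cells, without choosing one. *)
Definition all_cells_odd (T : finType) (P : {set {set T}}) :=
  [forall A in P, odd #|A|].

Lemma all_cells_odd_leaf n (X : {set 'I_n}) :
  ~~ odd n -> all_cells_odd (leaf_cells X) = odd #|X|.
Proof.
move=> n_even; have card_leaf (Y : {set 'I_n}) : #|[set Some i | i in Y]| = #|Y|.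
  by rewrite card_imset //; apply: Some_inj.
have odC : odd #|~: X| = odd #|X|.
  by move: n_even; rewrite -{1}[n]card_ord -(cardsC X) oddD; do 2!case: (odd _).
apply/forall_inP/idP => [/(_ _ (mem_leaf_cells X))|oX A]; first by rewrite card_leaf.
by rewrite !inE -orbA => /or3P[] /eqP->; rewrite ?cards1 // card_leaf ?odC.
Qed.

Lemma edge_flips_parity n (p q : stirling_vertex (star n) 3) :
    2 <= n -> ~~ odd n -> stirling_edge p q ->
  all_cells_odd (val q) = ~~ all_cells_odd (val p).
Proof.
move=> n2 n_even /andP[/eqP neq_pq /existsP[x /eqP eq_x]].
have i : 'I_n by exists 0; apply: leq_trans n2.
have [X [_ _ defp]] := vertex_leaf_cells i (valP p).
have [Y [_ _ defq]] := vertex_leaf_cells i (valP q).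
move: eq_x; rewrite defp defq => /(cells_agree n2)[X' [Y' [eqX eqY agree]]].
have {}neq_pq : X' <> Y'.
  by move=> eqXY; apply: neq_pq; apply: val_inj; rewrite defp defq -eqX -eqY eqXY.
rewrite -eqX -eqY !all_cells_odd_leaf //.
case: x agree => [a|] agree; last by case: neq_pq; apply/setP=> j; apply: agree.
have eqD : X' :\ a = Y' :\ a.
  apply/setP=> j; rewrite !inE; case: eqVneq => //= ja; apply: agree.
  by apply: contraNneq ja => -[->].
rewrite (cardsD1 a X') (cardsD1 a Y') eqD !oddD !oddb.
case aX: (a \in X'); case aY: (a \in Y'); rewrite ?negbK //=; case: neq_pq.
  by rewrite -(setD1K aX) -(setD1K aY) eqD.
have D1 (Z : {set 'I_n}) : a \in Z = false -> Z :\ a = Z.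
  by move=> aZ; apply/setDidPl; rewrite disjoint_sym disjoints1 aZ.
by rewrite -(D1 _ aX) -(D1 _ aY).
Qed.

(** * Odd number of leaves *)

(** For vectors of length [n.-1] the default value of [nth] keeps the last leaf
    out of the support. *)
Definition support n (x : seq bool) : {set 'I_n} := [set i : 'I_n | nth false x i].

(** Distinct vectors have supports that avoid the last leaf, hence distinct
    partitions; an edge of the cube moves one leaf, and the last leaf closes the
    cycle.  Uniqueness and length show that every vertex is visited. *)
Lemma hamiltonian_odd_star k : hamiltonian (stirling_graph (star k.*2.+3) 3).
Proof.
set n := k.*2.+2; pose S x := support n.+1 x.
have maxS x : x \in punctured k -> ord_max \notin S x.
  by move=> /punctured_size sx; rewrite inE nth_default // sx.
have vertexS x : x \in punctured k ->
    @independent_partition (star n.+1) 3 (leaf_cells (S x)).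
  move=> xP; apply: leaf_cells_vertex; last first.
    by apply: contraNneq (maxS _ xP) => ->; rewrite inE.
  have := punctured_neq0 xP; rewrite -index_mem => lt_i.
  have lt_in : index true x < n.+1.
    by rewrite (leq_trans lt_i) // (punctured_size xP).
  by apply/set0Pn; exists (Ordinal lt_in); rewrite inE nth_index // -index_mem.
have headP : head [::] (punctured k) \in punctured k.
  by case: (punctured k) (punctured_gt0 k) => //= x s _; rewrite mem_head.
pose p0 : stirling_vertex (star n.+1) 3 := Sub _ (vertexS _ headP).
pose f x := insubd p0 (leaf_cells (S x)).
have val_f x : x \in punctured k -> val (f x) = leaf_cells (S x).
  by move=> xP; rewrite val_insubd vertexS.
have f_inj : {in punctured k &, injective f}.
  move=> x y xP yP /(congr1 val); rewrite !val_f //.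
  move=> /leaf_cells_inj-/(_ _ (maxS _ xP) (maxS _ yP)) eqS.
  have [sx sy] := (punctured_size xP, punctured_size yP).
  apply: (@eq_from_nth _ false) => [|j]; rewrite sx ?sy // => ltj.
  have /setP/(_ (widen_ord (leqnSn n) (Ordinal ltj))) := eqS.
  by rewrite !inE.
have uniq_c : uniq (map f (punctured k)) by rewrite map_inj_in_uniq // uniq_punctured.
have size_c : (size (map f (punctured k))).+1 = 2 ^ n by rewrite size_map size_punctured.
have size_gt2 : 2 < size (map f (punctured k)).
  by rewrite -ltnS size_c !expnS; have := expn_gt0 2 k.*2; lia.
exists (map f (punctured k)); split=> //.
  rewrite /ucycle uniq_c andbT.
  have fadj : {in punctured k &, forall x y, cube_adj x y -> stirling_edge (f x) (f y)}.
    move=> x y xP yP adj_xy; have [i lti agree] := cube_adj_nth adj_xy.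
    have ltin : i < n.+1 by rewrite (leq_trans lti) // (punctured_size xP).
    apply: (leaf_edge (i := Ordinal ltin) (val_f _ xP) (val_f _ yP)) => [|j neq_j].
      rewrite (inj_in_eq f_inj) //; apply: contraTneq adj_xy => ->.
      by rewrite cube_adjxx.
    by rewrite !inE agree.
  have lastP : last [::] (punctured k) \in punctured k.
    by case: (punctured k) (punctured_gt0 k) => //= x s _; rewrite mem_last.
  (* The two ends are complementary on all leaves but the last, which neither
     support contains; so one equals the complement of the other off the last leaf. *)
  have closing :
      stirling_edge (f (last [::] (punctured k))) (f (head [::] (punctured k))).
    apply: (@leaf_edge _ _ _ (S (last [::] (punctured k)))
                       (~: S (head [::] (punctured k))) ord_max).
    - exact: val_f.
    - by rewrite val_f // leaf_cellsC.
    - by rewrite (inj_in_eq f_inj) // last_punctured head_punctured.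
    move=> j neq_j; rewrite !inE last_punctured head_punctured.
    have ltj : j < n by rewrite ltn_neqAle neq_j -ltnS ltn_ord.
    case: {neq_j} (nat_of_ord j) ltj => // i lti.
    have {}lti : i < k.*2.+1 by [].
    rewrite -[LHS]/(nth false (nseq k.*2.+1 true) i).
    rewrite -[X in ~~ X]/(nth false (nseq k.*2.+1 false) i).
    by rewrite !nth_nseq lti.
  have sorted_f : sorted (relpre f (@stirling_edge (star n.+1) 3)) (punctured k).
    have all_in : all (mem (punctured k)) (punctured k) by apply/allP.
    exact: (sub_in_sorted fadj all_in (sorted_punctured k)).
  case: (punctured k) closing sorted_f => //= x s closing path_s.
  by rewrite rcons_path path_map path_s last_map.
have c_all : map f (punctured k) =i predT.
  apply/subset_cardP; last exact: subset_predT.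
  by rewrite (card_uniqP uniq_c) card_vertices -size_c.
by move=> p; rewrite c_all.
Qed.

Theorem theorem4p4 (n : nat) (hn : 2 <= n) :
  hamiltonian (stirling_graph (star n) 3) <-> odd n.
Proof.
split=> [[c [_ /andP[cyc_c uniq_c] all_c]]|n_odd]; last first.
  have [k ->] : exists k, n = k.*2.+3 by exists n./2.-1; lia.
  exact: hamiltonian_odd_star.
case: (boolP (odd n)) => // n_even.
have := two_coloured_cycle_even (fun p q => @edge_flips_parity n p q hn n_even) cyc_c.
have -> : size c = #|{: stirling_vertex (star n) 3}|.
  by rewrite -(card_uniqP uniq_c); apply: eq_card => p; rewrite all_c.
case: n hn {c cyc_c uniq_c all_c n_even} => [|[|n]] // _.
by rewrite card_vertices expnS -subn1 oddB ?muln_gt0 ?expn_gt0 // oddM.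
Qed.
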